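(* Let $\Sigma$ be a finite nonempty alphabet, $n \ge 1$ an integer, and $S = \{x_1, \ldots, x_k\} \subseteq \Sigma^*$ with $|x_i| \le n$ for all $i$. If $S^*$ is co-finite, then every word in $\Sigma^* \setminus S^*$ has length strictly less than $$\frac{2}{2|\Sigma| - 1}\left(2^n |\Sigma|^n - 1\right).$$
   Context: A language $L \subseteq \Sigma^*$ is co-finite if $\Sigma^* \setminus L$ is finite. *)

(* Defs.v *)
From mathcomp Require Import all_boot all_order all_algebra.
From mathcomp Require Import boolp classical_sets cardinality.

Set Implicit Arguments.
Unset Strict Implicit.
Unset Printing Implicit Defensive.

Local Open Scope classical_set_scope.

(* Languages over an alphabet T are sets of words, i.e. [set (seq T)]; the
   empty list of factors yields the empty word. *)
Definition star (T : eqType) (S : set (seq T)) : set (seq T) :=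
  [set w | exists2 ws : seq (seq T), (forall x, x \in ws -> S x) & w = flatten ws].

Definition cofinite_language (T : eqType) (L : set (seq T)) : Prop :=
  finite_set (~` L).

(* Main.v *)
Require Import Defs.
From mathcomp Require Import all_boot all_order all_algebra.
From mathcomp Require Import boolp classical_sets cardinality.
From mathcomp Require Import ring lra.

Set Implicit Arguments.
Unset Strict Implicit.
Unset Printing Implicit Defensive.

Import GRing.Theory Num.Theory.

Local Open Scope classical_set_scope.
Local Open Scope ring_scope.

(** Read words from right to left. Whether [a :: r] lies in the star depends
    only on the first [n - 1] letters of [r] and on which of the suffixes of
    [r] obtained by dropping at most [n - 1] letters lie in the star. This data
    ([star_state] below) is the state of a deterministic automaton for the
    star, with at most [\sum_(i < n) |Sigma|^i 2^(i+1)] states, the claimed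
    bound. A rejected word at least as long as the number of states can be
    pumped, so it yields infinitely many rejected words. *)

(** Empty factors can be skipped, and the first nonempty one starts with [a]. Writing it as
    [a :: take j r] makes the rest a suffix of [r]. *)
Lemma star_consP (T : eqType) (S : set (seq T)) (a : T) (r : seq T) :
  star S (a :: r) <->
  exists j, [/\ (j <= size r)%N, S (a :: take j r) & star S (drop j r)].
Proof.
split=> [[ws] | [j [_ Sx [ws Sws def_r]]]]; last first.
  exists ((a :: take j r) :: ws); last by rewrite /= -def_r cat_take_drop.
  by move=> x; rewrite inE => /orP[/eqP-> | /Sws].
elim: ws => [|[|b x] ws IHws] //= Sws.
  by apply: IHws => x x_ws; apply: Sws; rewrite inE x_ws orbT.
case=> -> ->; exists (size x); rewrite take_size_cat // drop_size_cat //.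
split; first by rewrite size_cat leq_addr.
  by apply: Sws; rewrite mem_head.
by exists ws => // y y_ws; apply: Sws; rewrite inE y_ws orbT.
Qed.

(** Here [m] stands for [n - 1]. The number of bits depends on the length [i] of the stored prefix,
    so that such a prefix allows only [2 ^ i.+1] bit vectors. *)
Definition star_state (T : eqType) (S : set (seq T)) (m : nat) (w : seq T) :
    seq T * seq bool :=
  (take m w,
   [seq `[< star S (drop j w) >] | j <- iota 0 (size (take m w)).+1]).

Lemma star_stateP (T : eqType) (S : set (seq T)) (m : nat) (r s : seq T) :
  star_state S m r = star_state S m s <->
  take m r = take m s /\
  forall j, (j <= size (take m r))%N ->
    star S (drop j r) <-> star S (drop j s).
Proof.
rewrite /star_state; split=> [eq_state | [eq_take eq_star]].
  have eq_take : take m r = take m s := congr1 fst eq_state.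
  have := congr1 snd eq_state; rewrite [_.2]/snd -eq_take => eq_bits; split=> // j le_j.
  apply: asbool_eq_equiv; have /eq_in_map := eq_bits; apply.
  by rewrite mem_iota add0n ltnS.
rewrite -eq_take; congr pair; apply/eq_in_map => j.
rewrite mem_iota add0n ltnS /= => le_j.
exact/asbool_equiv_eq/eq_star.
Qed.

(** A factor starting at [a] reaches at most [m] letters into the tail: the stored prefix shows it,
    and a stored bit decides the suffix it leaves. *)
Lemma star_state_cons (T : eqType) (S : set (seq T)) (m : nat)
    (S_size : forall x, S x -> (size x <= m.+1)%N) (a : T) (r s : seq T) :
  star_state S m r = star_state S m s ->
  star_state S m (a :: r) = star_state S m (a :: s).
Proof.
move=> /star_stateP[eq_take eq_star].
have eq_takel j : (j <= m)%N -> take j r = take j s.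
  by move=> le_jm; rewrite -(take_takel r le_jm) eq_take take_takel.
have star_acons (x y : seq T) : take m x = take m y ->
    (forall j, (j <= size (take m x))%N ->
       star S (drop j x) <-> star S (drop j y)) ->
    star S (a :: x) -> star S (a :: y).
  move=> eq_xy star_xy /star_consP[j [le_jx Sj star_j]].
  have le_jm : (j <= m)%N.
    by have := S_size _ Sj; rewrite /= size_takel.
  have le_j : (j <= size (take m x))%N by rewrite size_take_min leq_min le_jm.
  apply/star_consP; exists j; split; last exact/star_xy.
    have := le_j; rewrite eq_xy size_take_min leq_min => /andP[_ ->] //.
  by rewrite -(take_takel y le_jm) -eq_xy take_takel.
apply/star_stateP; split=> [|[|j] /=].
- by case: m eq_takel {S_size eq_take eq_star star_acons} => //= m ->.
- move=> _; split; apply: star_acons => // j; rewrite -?eq_take => le_j.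
  by split=> /eq_star; apply.
(* Apart from the bit of the whole word, the bits are those of the tail shifted by one. *)
case: m S_size eq_take eq_star eq_takel star_acons => //= m _ _ eq_star _ _ le_j.
apply: eq_star; move: le_j; rewrite ltnS !size_take_min !leq_min.
by case/andP=> /leqW-> ->.
Qed.

Lemma star_state_cat (T : eqType) (S : set (seq T)) (m : nat)
    (S_size : forall x, S x -> (size x <= m.+1)%N) (u r s : seq T) :
  star_state S m r = star_state S m s ->
  star_state S m (u ++ r) = star_state S m (u ++ s).
Proof. by move=> eq_rs; elim: u => //= a u; apply: star_state_cons. Qed.

Lemma star_state_star (T : eqType) (S : set (seq T)) (m : nat) (r s : seq T) :
  star_state S m r = star_state S m s -> star S r <-> star S s.
Proof. by move=> /star_stateP[_ /(_ 0%N isT)]; rewrite !drop0. Qed.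

(** A list containing every possible state, grouped by prefix length; a superset suffices for the
    pigeonhole argument. *)
Definition star_states (T : finType) (m : nat) : seq (seq T * seq bool) :=
  flatten [seq [seq (tval p.1, tval p.2)
               | p <- enum {: i.-tuple T * i.+1.-tuple bool}]
          | i <- iota 0 m.+1].

Lemma size_star_states (T : finType) (m : nat) :
  size (star_states T m) = (\sum_(i < m.+1) #|T| ^ i * 2 ^ i.+1)%N.
Proof.
rewrite size_flatten /shape -map_comp sumnE big_map.
rewrite -[iota _ _]/(index_iota 0 m.+1) big_mkord; apply: eq_bigr => i _ /=.
by rewrite size_map -cardE card_prod !card_tuple card_bool.
Qed.

Lemma mem_star_states (T : finType) (S : set (seq T)) (m : nat) (w : seq T) :
  star_state S m w \in star_states T m.
Proof.
apply/flatten_mapP; exists (size (take m w)).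
  by rewrite mem_iota add0n ltnS size_take_min geq_minl.
have size_bits : size (star_state S m w).2 == (size (take m w)).+1.
  by rewrite size_map size_iota.
by apply/mapP; exists (in_tuple (take m w), Tuple size_bits); rewrite ?mem_enum.
Qed.

Lemma cofinite_language_bounded (T : choiceType) (L : set (seq T)) :
  cofinite_language L -> exists M, forall w, ~ L w -> (size w <= M)%N.
Proof.
move=> /finite_seqP[s def_s]; exists (\max_(x <- s) size x)%N => w Lw.
have w_s : [set` s] w by rewrite -def_s.
exact: leq_bigmax_seq w_s isT.
Qed.

Lemma size_notin_cofinite_star (T : finType) (S : set (seq T)) (m : nat) :
    (forall x, S x -> (size x <= m.+1)%N) -> cofinite_language (star S) ->
  forall w, ~ star S w -> (size w < size (star_states T m))%N.
Proof.
move=> S_size /cofinite_language_bounded[M leM] w Sw.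
rewrite ltnNge; apply/negP => le_w; set N := size _ in le_w.
(* As [w] has at least [N] letters, the offsets [0] to [N] give [N.+1] distinct suffixes for at most
   [N] states. *)
pose sts := [seq star_state S m (drop i w) | i <- iota 0 N.+1].
have [uniq_sts | ] := boolP (uniq sts).
  have sub_sts : {subset sts <= star_states T m}.
    by move=> _ /mapP[i _ ->]; apply: mem_star_states.
  by have := uniq_leq_size uniq_sts sub_sts; rewrite size_map size_iota ltnn.
case/(uniqPn (star_state S m [::])) => i [j []].
rewrite size_map size_iota => lt_ij lt_jN.
have lt_iN := ltn_trans lt_ij lt_jN.
rewrite !(nth_map 0%N) ?size_iota // !nth_iota // !add0n.
(* The block between two suffixes with equal states is a loop of the automaton. *)
pose v := take (j - i) (drop i w).
have def_v : drop i w = v ++ drop j w.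
  by rewrite -[LHS](cat_take_drop (j - i)) drop_drop subnK // ltnW.
rewrite def_v => eq_v.
have eq_pump k : star_state S m (iter k (cat v) (drop j w)) =
    star_state S m (drop j w).
  by elim: k => //= k IHk; rewrite -[RHS]eq_v; apply: star_state_cat.
have size_v : (0 < size v)%N.
  rewrite size_takel ?subn_gt0 // size_drop leq_sub2r //.
  by rewrite (leq_trans _ le_w).
have size_pump k : (k <= size (iter k (cat v) (drop j w)))%N.
  by elim: k => //= k IHk; rewrite size_cat -add1n leq_add.
(* Pumping preserves the state, hence rejection; [M.+1] copies of the nonempty [v] exceed the bound
   [M] on rejected words. *)
have: ~ star S (take i w ++ iter M.+1 (cat v) (drop j w)).
  move=> star_pump; apply: Sw; rewrite -(cat_take_drop i w).
  have eq_w : star_state S m (drop i w) =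
      star_state S m (iter M.+1 (cat v) (drop j w)) by rewrite def_v eq_pump.
  exact/(star_state_star (star_state_cat S_size _ eq_w)).
move/leM; rewrite size_cat leqNgt => /negP; apply.
by rewrite (leq_trans (size_pump _)) // leq_addl.
Qed.

Theorem theorem16 (Sigma : finType) (n : nat) (S : set (seq Sigma))
    (Sigma_nonempty : (0 < #|Sigma|)%N)
    (n_ge1 : (1 <= n)%N)
    (S_finite : finite_set S)
    (S_size : forall x : seq Sigma, S x -> (size x <= n)%N)
    (star_cofinite : cofinite_language (star S)) :
  forall w : seq Sigma, ~ star S w ->
    (size w)%:R <
      2 / (2 * #|Sigma|%:R - 1) * (2 ^+ n * #|Sigma|%:R ^+ n - 1) :> rat.
Proof.
case: n n_ge1 S_size => // m _ S_size w.
move/(size_notin_cofinite_star S_size star_cofinite); rewrite size_star_states.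
set k := #|Sigma| in Sigma_nonempty *.
have k_ge1 : 1 <= k%:R :> rat by rewrite ler1n.
have den_neq0 : 2 * k%:R - 1 != 0 :> rat by apply/eqP => den0; lra.
suff -> : 2 / (2 * k%:R - 1) * (2 ^+ m.+1 * k%:R ^+ m.+1 - 1) =
    (\sum_(i < m.+1) k ^ i * 2 ^ i.+1)%:R :> rat by rewrite ltr_nat.
(* Geometric sum of ratio [2 * k%:R]: its factor [2 * k%:R - 1] cancels the denominator. *)
rewrite -exprMn subrX1 mulrA divfK // mulr_sumr natr_sum.
by apply: eq_bigr => i _; rewrite natrM !natrX exprMn exprS; ring.
Qed.
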